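(* Let $\Omega=\{r<0\}\subset\mathbb{C}^2$ with $0\in b\Omega$, where $r(z,w)=\operatorname{Im} w+F(z,\bar z,\operatorname{Re}w,\operatorname{Im}w)$ and all terms of $F$ are of degree at least $2$. Suppose that $\rho=r\cdot h$ is a local plurisubharmonic defining function for $\Omega$ on the boundary near the origin, where $h$ is a real-valued function that does not vanish in a neighborhood of the origin. Then there are a neighborhood $U$ of the origin, a constant $C>0$ and a function $E$ on $U\cap b\Omega$ such that on $U\cap b\Omega$ $$\frac{\partial}{\partial z}\log h=-\frac{\partial}{\partial z}\log r_{\bar w}+E,\qquad |E|^2\le C\left(\mathcal{L}_r+|r_z|^2\right).$$
   Context: Coordinates on $\mathbb{C}^2$ are $(z,w)$; subscripts denote partial derivatives, e.g. $r_z=\partial r/\partial z$, $r_{\bar w}=\partial r/\partial\bar w$, $r_{z\bar w}=\partial^2 r/\partial z\,\partial\bar w$. All functions $r,h,\rho$ are assumed smooth. A real-valued function $r$ is a defining function for $\Omega$ if $\Omega=\{r<0\}$ and $\nabla r\neq0$ on the boundary $b\Omega$. The normalization of $r$ guarantees $r_w\ne0$ near the origin. A local plurisubharmonic defining function on the boundary near $0$ is a real-valued function $\rho$, defined near $0$, such that for some neighborhood $V$ of $0$: $\Omega\cap V=\{\rho<0\}\cap V$, $\nabla\rho\ne0$ on $b\Omega\cap V$, and the complex Hessian matrix of $\rho$ is positive semidefinite (on all vectors of $\mathbb{C}^2$) at every point of $b\Omega\cap V$. The Levi form is $$\mathcal{L}_r=r_{z\bar z}|r_w|^2+r_{w\bar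 w}|r_z|^2-2\operatorname{Re}[r_{z\bar w}r_wr_{\bar z}].$$ The logarithmic derivatives mean $\frac{\partial}{\partial z}\log h=h_z/h$ and $\frac{\partial}{\partial z}\log r_{\bar w}=r_{z\bar w}/r_{\bar w}$. *)

(* Defs.v *)
From Stdlib Require Import Reals List.
From Coquelicot Require Import Coquelicot.
Open Scope R_scope.

(* Points of C^2 are pairs (z, w), with z = x + i y and w = u + i v. *)
Definition C2 : Type := (C * C)%type.
Definition origin : C2 := (RtoC 0, RtoC 0).

Inductive axis : Set := axis_x | axis_y | axis_u | axis_v.

Definition shift (d : axis) (t : R) (p : C2) : C2 :=
  match d with
  | axis_x => (Cplus (fst p) (RtoC t), snd p)
  | axis_y => (Cplus (fst p) (Cmult Ci (RtoC t)), snd p)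
  | axis_u => (fst p, Cplus (snd p) (RtoC t))
  | axis_v => (fst p, Cplus (snd p) (Cmult Ci (RtoC t)))
  end.

Definition partial (d : axis) (f : C2 -> R) (p : C2) : R :=
  Derive (fun t => f (shift d t p)) 0.

Fixpoint iter_partial (l : list axis) (f : C2 -> R) : C2 -> R :=
  match l with
  | nil => f
  | d :: l' => partial d (iter_partial l' f)
  end.

(* C^infinity in the real sense: all iterated partial derivatives exist and
   are continuous.  Only used with an open set D. *)
Definition smooth_on (D : C2 -> Prop) (f : C2 -> R) : Prop :=
  forall (p : C2) (l : list axis), D p ->
    continuous (iter_partial l f) p /\
    forall d : axis, ex_derive (fun t => iter_partial l f (shift d t p)) 0.

Definition open_nbhd (p : C2) (V : C2 -> Prop) : Prop :=
  open V /\ V p.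

Definition boundary (Omega : C2 -> Prop) (p : C2) : Prop :=
  forall P : C2 -> Prop, locally p P ->
    (exists q, P q /\ Omega q) /\ (exists q, P q /\ ~ Omega q).

Definition gradient_nonzero (f : C2 -> R) (p : C2) : Prop :=
  exists d : axis, partial d f p <> 0.

(* The terms of degree < m of the Taylor expansion of f at the origin vanish. *)
Definition terms_of_degree_at_least (m : nat) (f : C2 -> R) : Prop :=
  forall l : list axis, (length l < m)%nat -> iter_partial l f origin = 0.

Definition Cfun (f : C2 -> R) : C2 -> C := fun p => RtoC (f p).

Definition Cpartial (d : axis) (f : C2 -> C) (p : C2) : C :=
  (partial d (fun q => Re (f q)) p, partial d (fun q => Im (f q)) p).

(* Wirtinger derivatives d/dz, d/d(zbar), d/dw, d/d(wbar). *)
Definition dz (f : C2 -> C) (p : C2) : C :=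
  ((Cpartial axis_x f p - Ci * Cpartial axis_y f p) / RtoC 2)%C.
Definition dzb (f : C2 -> C) (p : C2) : C :=
  ((Cpartial axis_x f p + Ci * Cpartial axis_y f p) / RtoC 2)%C.
Definition dw (f : C2 -> C) (p : C2) : C :=
  ((Cpartial axis_u f p - Ci * Cpartial axis_v f p) / RtoC 2)%C.
Definition dwb (f : C2 -> C) (p : C2) : C :=
  ((Cpartial axis_u f p + Ci * Cpartial axis_v f p) / RtoC 2)%C.

(* d/dz (log f), for complex-valued f, without choosing a branch. *)
Definition dz_log (f : C2 -> C) (p : C2) : C := (dz f p / f p)%C.

Definition complex_hessian_form (f : C2 -> R) (p : C2) (a b : C) : C :=
  (dz (dzb (Cfun f)) p * a * Cconj a + dz (dwb (Cfun f)) p * a * Cconj b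
   + dw (dzb (Cfun f)) p * b * Cconj a + dw (dwb (Cfun f)) p * b * Cconj b)%C.

Definition complex_hessian_psd (f : C2 -> R) (p : C2) : Prop :=
  forall a b : C,
    Im (complex_hessian_form f p a b) = 0 /\
    0 <= Re (complex_hessian_form f p a b).

(* For smooth real f the entries f_{z zbar} and f_{w wbar} are real, so taking
   their real parts only changes the type. *)
Definition levi (f : C2 -> R) (p : C2) : R :=
  Re (dz (dzb (Cfun f)) p) * (Cmod (dw (Cfun f) p)) ^ 2
  + Re (dw (dwb (Cfun f)) p) * (Cmod (dz (Cfun f) p)) ^ 2
  - 2 * Re (dz (dwb (Cfun f)) p * dw (Cfun f) p * dzb (Cfun f) p)%C.

Definition defining_function (r : C2 -> R) (Omega : C2 -> Prop) : Prop :=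
  smooth_on (fun _ => True) r /\
  (forall p, Omega p <-> r p < 0) /\
  (forall p, boundary Omega p -> gradient_nonzero r p).

(* The values of rho far from the origin are irrelevant: this renders a
   function that is only defined near the origin. *)
Definition local_psh_defining_function_on_boundary
    (rho : C2 -> R) (Omega : C2 -> Prop) : Prop :=
  exists V : C2 -> Prop,
    open_nbhd origin V /\
    smooth_on V rho /\
    (forall p, V p -> (Omega p <-> rho p < 0)) /\
    (forall p, V p -> boundary Omega p -> gradient_nonzero rho p) /\
    (forall p, V p -> boundary Omega p -> complex_hessian_psd rho p).

(* Main.v *)
Require Import Defs.
From Stdlib Require Import Reals Lra.
From Coquelicot Require Import Coquelicot.
Open Scope R_scope.

(** Write [B = rho_{z wbar}] for [rho = r h].  Where [r = 0] the product rule
    leaves [B = h r_{z wbar} + r_z h_wbar + h_z r_wbar], so the error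
    [E = h_z / h + r_{z wbar} / r_wbar] satisfies
    [E h r_wbar = B - r_z h_wbar].  As [h] and [r_wbar] are bounded away from
    zero near the origin, it suffices to bound [|B|^2] by a multiple of
    [levi r + |r_z|^2].

    Let [Q] be the complex Hessian form of [rho], with diagonal entries
    [A = rho_{z zbar}] and [D = rho_{w wbar}].  Positivity of [Q] gives
    [|B|^2 <= M A] as soon as [D <= M] ([off_diagonal_bound]).  To control [A],
    evaluate [Q] on the complex tangent vector [(r_w, - r_z)]: there the terms
    with first derivatives of [h] cancel, and the value is [h levi r]
    ([levi_product]).  Since [Q] is nonnegative at [(r_w, - 2 r_z)], its tangential
    value controls [A] up to [|r_z|^2]:
    [A |r_w|^2 <= 2 h levi r + 2 D |r_z|^2] ([diagonal_bound]).

    Finally [h > 0] at the origin, because [r] and [r h] are both negative at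
    points of the domain that accumulate there; this makes [levi r] nonnegative
    on the boundary, so that all coefficients can be enlarged to one constant. *)

(** * Partial derivatives and the boundary *)

Lemma shift_zero (d : axis) (p : C2) : shift d 0 p = p.
Proof.
destruct p as [[x y] [u v]]; destruct d; unfold shift, Cplus, Cmult, RtoC, Ci;
  simpl; repeat f_equal; ring.
Qed.

Lemma locally_shift (d : axis) (p : C2) (P : C2 -> Prop) :
  locally p P -> locally 0 (fun t => P (shift d t p)).
Proof.
intros [eps H]; exists eps.
change (forall t : R, ball 0 eps t -> P (shift d t p)).
intros t Ht; apply H.
assert (Ht' : Rabs t < eps).
{ revert Ht; unfold ball; simpl; unfold AbsRing_ball, abs, minus, plus, opp; simpl.
  now rewrite Ropp_0, Rplus_0_r. }
assert (Hb : forall a b : R, b = a + t \/ b = a -> ball a eps b).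
{ intros a b Hab; change (Rabs (b - a) < eps).
  destruct Hab as [-> | ->].
  - now replace (a + t - a) with t by ring.
  - rewrite Rminus_diag, Rabs_R0; apply cond_pos. }
destruct p as [[x y] [u v]]; destruct d; split; split; simpl; apply Hb;
  first [left; ring | right; ring].
Qed.

(** A nonzero value of [r] would keep its sign on a neighborhood, which then
    would miss either the sublevel set or its complement. *)
Lemma boundary_sublevel_zero (Omega : C2 -> Prop) (r : C2 -> R) (p : C2) :
  (forall q, Omega q <-> r q < 0) -> continuous r p -> boundary Omega p ->
  r p = 0.
Proof.
intros HO Hc Hb.
destruct (Rtotal_order (r p) 0) as [Hneg | [Hz | Hpos]]; auto; exfalso.
- destruct (Hb (fun q => r q < 0)) as [_ [q [Hq Hn]]].
  + exact (Hc _ (open_lt 0 _ Hneg)).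
  + now apply Hn, HO.
- destruct (Hb (fun q => 0 < r q)) as [[q [Hq Hn]] _].
  + exact (Hc _ (open_gt 0 _ Hpos)).
  + apply HO in Hn; lra.
Qed.

Lemma continuous_locally_bounded (f : C2 -> R) (p : C2) :
  continuous f p ->
  locally p (fun q => Rabs (f q) <= Rabs (f p) + 1).
Proof.
intros Hc.
assert (Ha : continuous (fun q => Rabs (f q)) p)
  by (apply (continuous_comp f Rabs); [exact Hc | apply continuous_Rabs]).
apply (filter_imp (fun q => Rabs (f q) < Rabs (f p) + 1)); [intros q; lra |].
apply (Ha (fun y => y < Rabs (f p) + 1)), open_lt; lra.
Qed.

Lemma partial_mult (d : axis) (f g : C2 -> R) (p : C2) :
  ex_derive (fun t => f (shift d t p)) 0 ->
  ex_derive (fun t => g (shift d t p)) 0 ->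
  partial d (fun q => f q * g q) p = partial d f p * g p + f p * partial d g p.
Proof.
intros Hf Hg; unfold partial.
rewrite (Derive_mult (fun t => f (shift d t p)) (fun t => g (shift d t p)));
  auto.
now rewrite !shift_zero.
Qed.

(** The set [W] has to be open because the inner product rule must hold along a
    whole segment in direction [d] before it can be differentiated. *)
Lemma partial2_mult (W : C2 -> Prop) (r h : C2 -> R) (p : C2) (d e : axis) :
  open W -> smooth_on W r -> smooth_on W h -> W p ->
  partial d (partial e (fun q => r q * h q)) p =
  partial d (partial e r) p * h p + partial e r p * partial d h p
  + partial d r p * partial e h p + r p * partial d (partial e h) p.
Proof.
intros HW Hr Hh Hp.
pose proof (proj2 (Hr p nil Hp) d) as Hr0.
pose proof (proj2 (Hh p nil Hp) d) as Hh0.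
pose proof (proj2 (Hr p (cons e nil) Hp) d) as Hr1.
pose proof (proj2 (Hh p (cons e nil) Hp) d) as Hh1.
simpl in Hr0, Hh0, Hr1, Hh1.
assert (Hloc : locally 0 (fun t =>
  partial e (fun q => r q * h q) (shift d t p) =
  partial e r (shift d t p) * h (shift d t p)
  + r (shift d t p) * partial e h (shift d t p))).
{ apply (filter_imp (fun t => W (shift d t p))).
  - intros t Ht; apply partial_mult.
    + exact (proj2 (Hr _ nil Ht) e).
    + exact (proj2 (Hh _ nil Ht) e).
  - now apply locally_shift, HW. }
transitivity (partial d (fun q => partial e r q * h q) p
              + partial d (fun q => r q * partial e h q) p).
- unfold partial at 1; etransitivity; [exact (Derive_ext_loc _ _ _ Hloc) |].
  apply (Derive_plus (fun t => partial e r (shift d t p) * h (shift d t p))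
           (fun t => r (shift d t p) * partial e h (shift d t p)));
    now apply @ex_derive_mult.
- rewrite !partial_mult; auto; ring.
Qed.

(** * Wirtinger derivatives of real functions *)

Lemma Cpartial_half (d : axis) (g : C2 -> C) (a b : C2 -> R) (p : C2) :
  (forall q, g q = (a q / 2, b q / 2)) ->
  Cpartial d g p = (partial d a p / 2, partial d b p / 2).
Proof.
intros Hg; unfold Cpartial, partial.
f_equal; unfold Rdiv; rewrite Rmult_comm, <- Derive_scal;
  apply Derive_ext; intros t; rewrite Hg; simpl; field.
Qed.

Lemma Cpartial_Cfun (d : axis) (f : C2 -> R) (p : C2) :
  Cpartial d (Cfun f) p = RtoC (partial d f p).
Proof.
unfold Cpartial, Cfun, RtoC, partial; simpl; f_equal; apply Derive_const.
Qed.

Ltac C_components :=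
  unfold Cdiv, Cinv, Cmult, Cminus, Cplus, Copp, Cconj, RtoC, Ci; simpl;
  apply injective_projections; simpl.

Lemma dz_Cfun (f : C2 -> R) (p : C2) :
  dz (Cfun f) p = (partial axis_x f p / 2, - partial axis_y f p / 2).
Proof. unfold dz; rewrite !Cpartial_Cfun; C_components; field. Qed.

Lemma dzb_Cfun (f : C2 -> R) (p : C2) :
  dzb (Cfun f) p = (partial axis_x f p / 2, partial axis_y f p / 2).
Proof. unfold dzb; rewrite !Cpartial_Cfun; C_components; field. Qed.

Lemma dw_Cfun (f : C2 -> R) (p : C2) :
  dw (Cfun f) p = (partial axis_u f p / 2, - partial axis_v f p / 2).
Proof. unfold dw; rewrite !Cpartial_Cfun; C_components; field. Qed.

Lemma dwb_Cfun (f : C2 -> R) (p : C2) :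
  dwb (Cfun f) p = (partial axis_u f p / 2, partial axis_v f p / 2).
Proof. unfold dwb; rewrite !Cpartial_Cfun; C_components; field. Qed.

Lemma dz_dzb_Cfun (f : C2 -> R) (p : C2) :
  dz (dzb (Cfun f)) p =
  ((partial axis_x (partial axis_x f) p + partial axis_y (partial axis_y f) p) / 4,
   (partial axis_x (partial axis_y f) p - partial axis_y (partial axis_x f) p) / 4).
Proof.
unfold dz; rewrite !(Cpartial_half _ _ _ _ _ (dzb_Cfun f)); C_components; field.
Qed.

Lemma dz_dwb_Cfun (f : C2 -> R) (p : C2) :
  dz (dwb (Cfun f)) p =
  ((partial axis_x (partial axis_u f) p + partial axis_y (partial axis_v f) p) / 4,
   (partial axis_x (partial axis_v f) p - partial axis_y (partial axis_u f) p) / 4).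
Proof.
unfold dz; rewrite !(Cpartial_half _ _ _ _ _ (dwb_Cfun f)); C_components; field.
Qed.

Lemma dw_dwb_Cfun (f : C2 -> R) (p : C2) :
  dw (dwb (Cfun f)) p =
  ((partial axis_u (partial axis_u f) p + partial axis_v (partial axis_v f) p) / 4,
   (partial axis_u (partial axis_v f) p - partial axis_v (partial axis_u f) p) / 4).
Proof.
unfold dw; rewrite !(Cpartial_half _ _ _ _ _ (dwb_Cfun f)); C_components; field.
Qed.

(** * The complex Hessian of a product on the zero set of one factor *)

Lemma dz_dzb_mult (W : C2 -> Prop) (r h : C2 -> R) (p : C2) :
  open W -> smooth_on W r -> smooth_on W h -> W p -> r p = 0 ->
  dz (dzb (Cfun (fun q => r q * h q))) p =
  (dz (dzb (Cfun r)) p * h p + dz (Cfun r) p * dzb (Cfun h) p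
   + dz (Cfun h) p * dzb (Cfun r) p)%C.
Proof.
intros HW Hr Hh Hp r0.
rewrite !dz_dzb_Cfun, !(partial2_mult W r h p) by assumption.
rewrite !dz_Cfun, !dzb_Cfun, r0; C_components; field.
Qed.

Lemma dz_dwb_mult (W : C2 -> Prop) (r h : C2 -> R) (p : C2) :
  open W -> smooth_on W r -> smooth_on W h -> W p -> r p = 0 ->
  dz (dwb (Cfun (fun q => r q * h q))) p =
  (dz (dwb (Cfun r)) p * h p + dz (Cfun r) p * dwb (Cfun h) p
   + dz (Cfun h) p * dwb (Cfun r) p)%C.
Proof.
intros HW Hr Hh Hp r0.
rewrite !dz_dwb_Cfun, !(partial2_mult W r h p) by assumption.
rewrite !dz_Cfun, !dwb_Cfun, r0; C_components; field.
Qed.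

Lemma dw_dwb_mult (W : C2 -> Prop) (r h : C2 -> R) (p : C2) :
  open W -> smooth_on W r -> smooth_on W h -> W p -> r p = 0 ->
  dw (dwb (Cfun (fun q => r q * h q))) p =
  (dw (dwb (Cfun r)) p * h p + dw (Cfun r) p * dwb (Cfun h) p
   + dw (Cfun h) p * dwb (Cfun r) p)%C.
Proof.
intros HW Hr Hh Hp r0.
rewrite !dw_dwb_Cfun, !(partial2_mult W r h p) by assumption.
rewrite !dw_Cfun, !dwb_Cfun, r0; C_components; field.
Qed.

(** * Positive Hermitian forms on C^2 *)

Definition hermitian_form (A B B' D a b : C) : C :=
  (A * a * Cconj a + B * a * Cconj b + B' * b * Cconj a + D * b * Cconj b)%C.

(** Testing reality on [(1,0)], [(0,1)], [(1,1)] and [(1,i)] forces [A] and [D]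
    to be real and [B'] to be the conjugate of [B]. *)
Lemma hermitian_form_real_part (A B B' D : C) :
  (forall a b : C, Im (hermitian_form A B B' D a b) = 0) ->
  forall a b : C, Re (hermitian_form A B B' D a b) =
    Re A * Cmod a ^ 2 + Re D * Cmod b ^ 2 + 2 * Re (B * a * Cconj b)%C.
Proof.
intros Him a b; rewrite !Cmod2_alt.
pose proof (Him 1 0)%C as H1; pose proof (Him 0 1)%C as H2.
pose proof (Him 1 1)%C as H3; pose proof (Him 1 Ci)%C as H4.
destruct A as [A1 A2], B as [B1 B2], B' as [B3 B4], D as [D1 D2],
  a as [a1 a2], b as [b1 b2].
unfold hermitian_form, Cmult, Cplus, Cconj, Ci, RtoC, Re, Im in *; simpl in *.
assert (A2 = 0) by lra; assert (D2 = 0) by lra.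
assert (B4 = - B2) by lra; assert (B3 = B1) by lra; subst; ring.
Qed.

(** The Hermitian form with matrix entries [A], [B], [Cconj B], [D], seen as a
    real quadratic form. *)
Definition real_form (A D : R) (B a b : C) : R :=
  A * Cmod a ^ 2 + D * Cmod b ^ 2 + 2 * Re (B * a * Cconj b)%C.

Lemma real_form_diag_nonneg (A D : R) (B : C) :
  (forall a b : C, 0 <= real_form A D B a b) -> 0 <= A /\ 0 <= D.
Proof.
intros pos.
pose proof (pos 1 0)%C as H1; pose proof (pos 0 1)%C as H2; revert H1 H2.
unfold real_form; rewrite !Cmod_0, !Cmod_1.
unfold Cconj, RtoC, Cmult; simpl; lra.
Qed.

(** A determinant bound [|B|^2 <= A D] in which [D] is replaced by a positive
    upper bound [M]: the test vector [(1, - B / M)] then works even if [D = 0]. *)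
Lemma off_diagonal_bound (A D M : R) (B : C) :
  (forall a b : C, 0 <= real_form A D B a b) ->
  0 < M -> D <= M -> Cmod B ^ 2 <= M * A.
Proof.
intros pos HM HD.
assert (Hk : 0 < / M) by now apply Rinv_0_lt_compat.
assert (HkM : / M * M = 1) by (field; lra).
pose proof (pos 1 (RtoC (- / M) * B))%C as H; revert H.
unfold real_form; rewrite Cmod_mult, Rpow_mult_distr, !Cmod2_alt.
set (k := / M) in *; set (S := Re B ^ 2 + Im B ^ 2).
replace (Re (B * 1 * Cconj (RtoC (- k) * B))%C) with (- k * S)
  by (unfold S; destruct B; simpl; ring).
replace (Re (RtoC (- k)) ^ 2 + Im (RtoC (- k)) ^ 2) with (k ^ 2)
  by (simpl; ring).
simpl (Re 1); simpl (Im 1); intros H.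
assert (HS : 0 <= S) by (unfold S; nra).
assert (HDk : D * (k ^ 2 * S) <= k * S).
{ replace (k * S) with (M * (k ^ 2 * S)).
  - apply Rmult_le_compat_r; [apply Rmult_le_pos; [apply pow2_ge_0 | exact HS] | exact HD].
  - transitivity (k * M * (k * S)); [ring | rewrite HkM; ring]. }
assert (HA : k * S <= A) by lra.
apply (Rmult_le_compat_l M) in HA; [| lra].
replace (M * (k * S)) with (k * M * S) in HA by ring.
rewrite HkM in HA; lra.
Qed.

(** This is [Q(u+v) + Q(u-v) = 2 Q(u) + 2 Q(v)] for [u = (a, b)] and
    [v = (0, - b)], where [Q(u-v) = Q(a, 2b)] is dropped. *)
Lemma diagonal_bound (A D : R) (B a b : C) :
  (forall a' b' : C, 0 <= real_form A D B a' b') ->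
  A * Cmod a ^ 2 <= 2 * real_form A D B a b + 2 * D * Cmod b ^ 2.
Proof.
intros pos; pose proof (pos a (2 * b))%C as H; revert H.
unfold real_form; rewrite !Cmod2_alt.
destruct B as [b1 c1], a, b; unfold Cconj, RtoC, Cmult, Copp; simpl; lra.
Qed.

(** * The estimate *)

Lemma Cmod_sub_sqr (a b : C) :
  Cmod (a - b) ^ 2 <= 2 * Cmod a ^ 2 + 2 * Cmod b ^ 2.
Proof.
rewrite !Cmod2_alt; destruct a as [a1 a2], b as [b1 b2]; simpl.
pose proof (pow2_ge_0 (a1 + b1)); pose proof (pow2_ge_0 (a2 + b2)); lra.
Qed.

(** The vector [(r_w, - r_z)] is annihilated by the holomorphic differential of
    [r].  Where [r = 0], every term of the Hessian of [r h] that contains a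
    derivative of [h] has that differential or its conjugate as a factor, hence vanishes. *)
Lemma levi_product (W : C2 -> Prop) (r h : C2 -> R) (p : C2) :
  open W -> smooth_on W r -> smooth_on W h -> W p -> r p = 0 ->
  let rho := Cfun (fun q => r q * h q) in
  real_form (Re (dz (dzb rho) p)) (Re (dw (dwb rho) p)) (dz (dwb rho) p)
    (dw (Cfun r) p) (- dz (Cfun r) p)%C = h p * levi r p.
Proof.
intros HW Hr Hh Hp r0 rho; unfold rho.
rewrite (dz_dzb_mult W), (dz_dwb_mult W), (dw_dwb_mult W) by assumption.
unfold real_form, levi; rewrite !Cmod2_alt.
rewrite !dz_Cfun, !dzb_Cfun, !dw_Cfun, !dwb_Cfun.
destruct (dz (dzb (Cfun r)) p), (dz (dwb (Cfun r)) p), (dw (dwb (Cfun r)) p).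
simpl; field.
Qed.

(** The pointwise estimate, for [w], [z], [q], [k] standing for [r_w], [r_z],
    [r_wbar], [h_wbar], and [L] for the Levi form.  The bound [1 / 16] comes from
    [r_v >= 1 / 2], since [r_w] has imaginary part [- r_v / 2]. *)
Lemma error_bound (A D L H m M N : R) (B z w q k E : C) (h : R) :
  (forall a b : C, 0 <= real_form A D B a b) ->
  real_form A D B w (- z)%C = h * L ->
  (E * (h * q))%C = (B - z * k)%C ->
  Cmod q ^ 2 = Cmod w ^ 2 -> 1 / 16 <= Cmod w ^ 2 ->
  0 < m -> m <= h -> h <= H ->
  0 < M -> D <= M -> Cmod k ^ 2 <= N ->
  Cmod E ^ 2 <=
    16 / m ^ 2 * (64 * M * H + 64 * M ^ 2 + 2 * N) * (L + Cmod z ^ 2).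
Proof.
intros pos HL HE Hq Hw Hm Hmh HhH HM HDM HkN.
destruct (real_form_diag_nonneg A D B pos) as [HA HD].
pose proof (off_diagonal_bound A D M B pos HM HDM) as HB.
pose proof (diagonal_bound A D B w (- z)%C pos) as Hdiag.
pose proof (pos w (- z)%C) as HLpos.
pose proof (Cmod_sub_sqr B (z * k)%C) as Hsub.
rewrite HL, Cmod_opp in Hdiag; rewrite HL in HLpos.
rewrite <- HE, !Cmod_mult, !Rpow_mult_distr, Hq, Cmod_R in Hsub.
rewrite pow2_abs in Hsub.
pose proof (pow2_ge_0 (Cmod z)) as Hz; pose proof (pow2_ge_0 (Cmod E)) as HE2.
pose proof (pow2_ge_0 (Cmod k)) as Hk2.
set (Z := Cmod z ^ 2) in *; set (e := Cmod E ^ 2) in *.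
set (x := Cmod w ^ 2) in *; set (y := Cmod k ^ 2) in *; set (b := Cmod B ^ 2) in *.
clearbody Z e x y b.
(* Nonnegativity of [L] allows [h] to be replaced by [H]. *)
assert (HL0 : 0 <= L) by (apply (Rmult_le_reg_l h); lra).
assert (HhL : h * L <= H * L) by now apply Rmult_le_compat_r.
assert (HDZ : D * Z <= M * Z) by now apply Rmult_le_compat_r.
assert (HAx : A * (1 / 16) <= A * x) by now apply Rmult_le_compat_l.
assert (HA' : A <= 32 * (H * L) + 32 * (M * Z)) by lra.
assert (HMA : M * A <= M * (32 * (H * L) + 32 * (M * Z)))
  by (apply Rmult_le_compat_l; lra).
assert (HZy : Z * y <= Z * N) by now apply Rmult_le_compat_l.
assert (Hm2 : m ^ 2 <= h ^ 2) by nra.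
assert (Hlow : m ^ 2 * (1 / 16) <= h ^ 2 * x)
  by (apply Rmult_le_compat; nra).
assert (Hel : e * (m ^ 2 * (1 / 16)) <= e * (h ^ 2 * x))
  by now apply Rmult_le_compat_l.
assert (HN : 0 <= N) by lra.
assert (Hup : e * (m ^ 2 * (1 / 16)) <=
  (64 * M * H + 64 * M ^ 2 + 2 * N) * (L + Z)).
{ assert (0 <= M * H * Z) by (repeat apply Rmult_le_pos; lra).
  assert (0 <= (64 * M ^ 2 + 2 * N) * L) by (apply Rmult_le_pos; nra).
  nra. }
apply (Rmult_le_reg_r (m ^ 2 * (1 / 16))); [nra |].
eapply Rle_trans; [exact Hup |]; apply Req_le; field; lra.
Qed.

(** * Normalization at the origin and conclusion *)

Lemma smooth_on_subset (V W : C2 -> Prop) (f : C2 -> R) :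
  (forall p, W p -> V p) -> smooth_on V f -> smooth_on W f.
Proof. intros HWV Hf p l Hp; apply Hf; auto. Qed.

Lemma partial_v_of_normalized (r F : C2 -> R) :
  (forall p, r p = Im (snd p) + F p) -> terms_of_degree_at_least 2 F ->
  ex_derive (fun t => r (shift axis_v t origin)) 0 ->
  partial axis_v r origin = 1.
Proof.
intros HrF HF Hex.
assert (HFv : partial axis_v F origin = 0)
  by (apply (HF (cons axis_v nil)); simpl; auto).
assert (Hid : forall t, F (shift axis_v t origin) = r (shift axis_v t origin) - t)
  by (intros t; rewrite HrF; simpl; ring).
revert HFv; unfold partial at 1; rewrite (Derive_ext _ _ _ Hid).
rewrite (Derive_minus (fun t => r (shift axis_v t origin)) (fun t => t));
  [| exact Hex | apply ex_derive_id].
rewrite Derive_id; exact (Rminus_diag_uniq _ _).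
Qed.

(** Were [h] negative near [p], a point of the domain close to [p] would make
    [r] and [r h] both negative. *)
Lemma factor_positive_at_boundary (Omega : C2 -> Prop) (r h : C2 -> R) (p : C2) :
  (forall q, Omega q <-> r q < 0) ->
  locally p (fun q => Omega q <-> r q * h q < 0) ->
  continuous h p -> h p <> 0 -> boundary Omega p -> 0 < h p.
Proof.
intros HO Hrho Hc Hne Hb.
destruct (Rle_lt_dec (h p) 0) as [Hle | Hlt]; auto; exfalso.
assert (Hneg : h p < 0) by lra.
destruct (Hb _ (filter_and _ _ Hrho (Hc _ (open_lt 0 _ Hneg))))
  as [[q [[Hq Hhq] HOq]] _].
pose proof (proj1 Hq HOq) as H1; pose proof (proj1 (HO q) HOq) as H2; nra.
Qed.

Theorem theorem1p1 :
  forall (Omega : C2 -> Prop) (r F h : C2 -> R),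
    defining_function r Omega ->
    boundary Omega origin ->
    (forall p : C2, r p = Im (snd p) + F p) ->
    terms_of_degree_at_least 2 F ->
    (exists W : C2 -> Prop,
       open_nbhd origin W /\ smooth_on W h /\ (forall p, W p -> h p <> 0)) ->
    local_psh_defining_function_on_boundary (fun p => r p * h p) Omega ->
    exists (U : C2 -> Prop) (K : R) (E : C2 -> C),
      open_nbhd origin U /\ 0 < K /\
      forall p : C2, U p -> boundary Omega p ->
        h p <> 0 /\ dwb (Cfun r) p <> RtoC 0 /\
        dz_log (Cfun h) p = Cplus (Copp (dz_log (dwb (Cfun r)) p)) (E p) /\
        (Cmod (E p)) ^ 2 <= K * (levi r p + (Cmod (dz (Cfun r) p)) ^ 2).
Proof.
intros Omega r F h [Hr [HO _]] Hb0 HrF HF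
  [W [[HW HW0] [Hh Hhne]]] [V [[HV HV0] [Hrho [HOrho [_ Hpsd]]]]].
pose (rho := fun p => r p * h p); fold rho in Hrho, Hpsd.
assert (HrW : smooth_on W r) by (apply (smooth_on_subset (fun _ => True)); auto).
assert (Hh0 : 0 < h origin).
{ apply (factor_positive_at_boundary Omega r); auto.
  - exact (filter_imp _ _ HOrho (HV _ HV0)).
  - exact (proj1 (Hh origin nil HW0)). }
assert (Hrv : partial axis_v r origin = 1)
  by exact (partial_v_of_normalized r F HrF HF (proj2 (Hr origin nil I) axis_v)).
pose (bound := fun f : C2 -> R => Rabs (f origin) + 1).
(* The pointwise estimate is uniform on [good]; its interior is the required
   open neighborhood. *)
pose (good := fun p : C2 =>
  V p /\ W p /\ h origin / 2 < h p /\ Rabs (h p) <= bound h /\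
  1 / 2 < partial axis_v r p /\
  Rabs (partial axis_u (partial axis_u rho) p)
    <= bound (partial axis_u (partial axis_u rho)) /\
  Rabs (partial axis_v (partial axis_v rho) p)
    <= bound (partial axis_v (partial axis_v rho)) /\
  Rabs (partial axis_u h p) <= bound (partial axis_u h) /\
  Rabs (partial axis_v h p) <= bound (partial axis_v h)).
assert (Hgood : locally origin good).
{ unfold good; repeat apply filter_and.
  - exact (HV _ HV0).
  - exact (HW _ HW0).
  - apply (proj1 (Hh origin nil HW0) (fun y => h origin / 2 < y)), open_gt.
    simpl; lra.
  - exact (continuous_locally_bounded _ _ (proj1 (Hh origin nil HW0))).
  - apply (proj1 (Hr origin (cons axis_v nil) I) (fun y => 1 / 2 < y)), open_gt.
    simpl; rewrite Hrv; lra.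
  - exact (continuous_locally_bounded _ _
      (proj1 (Hrho origin (cons axis_u (cons axis_u nil)) HV0))).
  - exact (continuous_locally_bounded _ _
      (proj1 (Hrho origin (cons axis_v (cons axis_v nil)) HV0))).
  - exact (continuous_locally_bounded _ _
      (proj1 (Hh origin (cons axis_u nil) HW0))).
  - exact (continuous_locally_bounded _ _
      (proj1 (Hh origin (cons axis_v nil) HW0))). }
pose (m := h origin / 2).
pose (M := (bound (partial axis_u (partial axis_u rho))
            + bound (partial axis_v (partial axis_v rho))) / 4).
pose (N := (bound (partial axis_u h) ^ 2 + bound (partial axis_v h) ^ 2) / 4).
assert (Hbound : forall f, 0 < bound f)
  by (intros f; unfold bound; pose proof (Rabs_pos (f origin)); lra).
assert (Hm : 0 < m) by (unfold m; lra).
assert (HM : 0 < M)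
  by (unfold M; pose proof (Hbound (partial axis_u (partial axis_u rho)));
      pose proof (Hbound (partial axis_v (partial axis_v rho))); lra).
assert (HN : 0 <= N)
  by (unfold N; pose proof (pow2_ge_0 (bound (partial axis_u h)));
      pose proof (pow2_ge_0 (bound (partial axis_v h))); lra).
exists (fun p => locally p good),
  (16 / m ^ 2 * (64 * M * bound h + 64 * M ^ 2 + 2 * N)),
  (fun p => Cplus (dz_log (Cfun h) p) (dz_log (dwb (Cfun r)) p)).
split; [split |].
- intros p Hp; now apply locally_locally.
- exact Hgood.
- split.
{ apply Rmult_lt_0_compat.
  - apply Rdiv_lt_0_compat; [lra | now apply pow_lt].
  - pose proof (Rmult_lt_0_compat _ _ HM (Hbound h)); nra. }
intros p Hp Hbp; apply locally_singleton in Hp.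
destruct Hp as [HpV [HpW [Hhm [HhH [Hrvp [Huu [Hvv [Hhu Hhv]]]]]]]].
assert (Hq : dwb (Cfun r) p <> RtoC 0).
{ rewrite dwb_Cfun; intros Heq; apply (f_equal snd) in Heq; simpl in Heq; lra. }
assert (Hhp : h p <> 0) by now apply Hhne.
assert (r0 : r p = 0)
  by exact (boundary_sublevel_zero Omega r p HO (proj1 (Hr p nil I)) Hbp).
split; [exact Hhp | split; [exact Hq | split; [ring |]]].
apply (error_bound
  (Re (dz (dzb (Cfun rho)) p)) (Re (dw (dwb (Cfun rho)) p))
  (levi r p) (bound h) m M N
  (dz (dwb (Cfun rho)) p) (dz (Cfun r) p) (dw (Cfun r) p)
  (dwb (Cfun r) p) (dwb (Cfun h) p) _ (h p)); auto.
- intros a b; unfold real_form.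
  rewrite <- (hermitian_form_real_part _ _ (dw (dzb (Cfun rho)) p)).
  + exact (proj2 (Hpsd p HpV Hbp a b)).
  + intros a' b'; exact (proj1 (Hpsd p HpV Hbp a' b')).
- now apply (levi_product W).
- unfold rho; rewrite (dz_dwb_mult W) by assumption; unfold dz_log.
  change (Cfun h p) with (RtoC (h p)).
  field; split; [exact Hq | now intros Heq; apply Hhp, RtoC_inj].
- rewrite dwb_Cfun, dw_Cfun, !Cmod2_alt; simpl; field.
- rewrite dw_Cfun, Cmod2_alt; simpl.
  pose proof (pow2_ge_0 (partial axis_u r p)); nra.
- unfold m; lra.
- now apply Rle_trans with (2 := HhH), Rle_abs.
- rewrite dw_dwb_Cfun; simpl; unfold M.
  pose proof (Rle_abs (partial axis_u (partial axis_u rho) p)).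
  pose proof (Rle_abs (partial axis_v (partial axis_v rho) p)); lra.
- rewrite dwb_Cfun, Cmod2_alt; unfold N; simpl Re; simpl Im.
  apply pow_maj_Rabs with (n := 2%nat) in Hhu.
  apply pow_maj_Rabs with (n := 2%nat) in Hhv.
  lra.
Qed.
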